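(* Let $q\ge 1$ be an integer and let $a_q(n)$ be the number of arrangements of black and white beads on a necklace with a total of $n$ beads such that there is at least one black bead, between any two (cyclically consecutive) black beads the number of white beads is divisible by $q$, and rotations and flippings of a necklace are considered distinct. If $n$ is prime then $a_q(n)\equiv 1\pmod n$. In particular, the Lucas numbers satisfy $L_n\equiv 1\pmod n$ for every prime $n$.
   Context: A necklace on $n$ beads is a coloring, black or white, of the $n$ positions $1,2,\ldots,n$ arranged cyclically (position $n$ adjacent to position $1$). Since rotations and flippings are considered distinct, necklaces are counted as functions from the set of labelled positions to $\{\text{black},\text{white}\}$. The divisibility condition is read cyclically: for each black bead, the number of white beads strictly between it and the next black bead encountered clockwise must be divisible by $q$; if there is exactly one black bead, there are $n-1$ white beads between it and itself, so the condition requires $q\mid n-1$. The Lucas numbers are defined by $L_0=2$, $L_1=1$, and $L_n=L_{n-1}+L_{n-2}$ for $n\ge 2$. *)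

(* Defs.v *)
From mathcomp Require Import all_boot.

Set Implicit Arguments.
Unset Strict Implicit.
Unset Printing Implicit Defensive.

(* Labelled necklaces: [true] is a black bead, [false] a white one, and the   *)
(* clockwise neighbour of bead [i] is [ordS i], i.e. [i + 1] modulo [n].      *)
Definition necklace (n : nat) := {ffun 'I_n -> bool}.

(* The [n] beads read clockwise from the neighbour of [i] end with [i]        *)
(* itself, so when [i] is black this is the number of white beads strictly    *)
(* between [i] and the next black bead, and it is [n.-1] when [i] is the only *)
(* black bead.                                                                *)
Definition white_gap (n : nat) (c : necklace n) (i : 'I_n) : nat :=
  find c (traject (@ordS n) (ordS i) n).

Definition admissible (q n : nat) (c : necklace n) : bool :=
  [exists i, c i] && [forall i, c i ==> (q %| white_gap c i)].

Definition num_necklaces (q n : nat) : nat :=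
  #|[set c : necklace n | admissible q c]|.

Fixpoint lucas (n : nat) : nat :=
  match n with
  | 0 => 2
  | m.+1 => if m is k.+1 then lucas m + lucas k else 1
  end.

(* Main.v *)
Require Import Defs.
From mathcomp Require Import all_boot.
From mathcomp Require Import all_algebra all_fingroup all_solvable.
From mathcomp Require ring.

Set Implicit Arguments.
Unset Strict Implicit.
Unset Printing Implicit Defensive.

(** For prime [n], rotation generates an [n]-group acting on the admissible
    necklaces, so their number is congruent modulo [n] to the number of fixed
    points; the only admissible necklace fixed by rotation is the all-black one.

    For the Lucas numbers, the roots of [X^2 - X - 1] are [X] and [1 - X], whence
    [L_n = X^n + (1 - X)^n] modulo this polynomial; in characteristic [n] the
    right-hand side is [(X + 1 - X)^n = 1]. *)

Lemma val_iter_ordS n k (i : 'I_n) : iter k (@ordS n) i = (i + k) %% n :> nat.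
Proof.
elim: k => [|k IHk]; first by rewrite addn0 modn_small.
by rewrite iterS /= IHk -addn1 modnDml addn1 addnS.
Qed.

Definition rotate n (c : necklace n) : necklace n := [ffun i => c (ordS i)].

Lemma rotate_inj n : injective (@rotate n).
Proof.
move=> c d /ffunP eq_cd; apply/ffunP => i.
by have := eq_cd (ord_pred i); rewrite !ffunE ord_predK.
Qed.

Definition rotation n : {perm necklace n} := perm (@rotate_inj n).

Lemma iter_rotate n k (c : necklace n) i :
  iter k (@rotate n) c i = c (iter k (@ordS n) i).
Proof. by elim: k i => // k IHk i; rewrite iterS ffunE IHk -iterSr. Qed.

Lemma rotationX n : (rotation n ^+ n = 1)%g.
Proof.
apply/permP => c; rewrite permX perm1 (eq_iter (permE (@rotate_inj n))).
apply/ffunP => i; rewrite iter_rotate; congr (c _); apply: val_inj.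
by rewrite /= val_iter_ordS modnDr modn_small.
Qed.

Lemma rotate_fixed_constant n (c : necklace n) :
  rotate c = c -> forall i j, c i = c j.
Proof.
(* The step count [j + (n - i)] represents [j - i] modulo [n] and avoids truncated subtraction when
   [j < i]. *)
move=> fix_c i j; have -> : j = iter (j + (n - i)) (@ordS n) i.
  apply: val_inj; rewrite /= val_iter_ordS addnCA subnKC ?modnDr ?modn_small //.
  exact: ltnW.
by rewrite -iter_rotate iter_fix.
Qed.

(** The walk from [ordS (ordS i)] is the image under [ordS] of the walk from [ordS i], so both
    searches meet the same colours in the same order. *)
Lemma white_gap_rotate n (c : necklace n) i :
  white_gap (rotate c) i = white_gap c (ordS i).
Proof.
have traject_map m x : traject (@ordS n) (ordS x) m =
    map (@ordS n) (traject (@ordS n) x m).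
  by elim: m x => //= m IHm x; rewrite IHm.
rewrite /white_gap [traject _ (ordS (ordS i)) n]traject_map find_map.
by apply: eq_find => j; rewrite /= ffunE.
Qed.

Lemma admissible_rotate q n (c : necklace n) :
  admissible q (rotate c) = admissible q c.
Proof.
rewrite /admissible; congr (_ && _).
  apply/existsP/existsP => [[i]|[i ci]]; first by rewrite ffunE; exists (ordS i).
  by exists (ord_pred i); rewrite ffunE ord_predK.
apply/forallP/forallP => adm i.
  by have := adm (ord_pred i); rewrite white_gap_rotate ffunE ord_predK.
by rewrite white_gap_rotate ffunE.
Qed.

Lemma admissible_rotate_fixed q n (c : necklace n) :
  0 < n -> admissible q c && (rotate c == c) = (c == [ffun=> true]).
Proof.
move=> n_gt0; apply/andP/eqP => [[/andP[/existsP[i ci] _] /eqP fix_c]|->].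
  by apply/ffunP => j; rewrite ffunE -(rotate_fixed_constant fix_c i).
split; last by apply/eqP/ffunP => i; rewrite !ffunE.
apply/andP; split; first by apply/existsP; exists (Ordinal n_gt0); rewrite ffunE.
apply/forallP => i; apply/implyP => _.
(* Writing [n] as a successor exposes the first bead of the walk; it is black, so every gap is 0. *)
by rewrite /white_gap -[X in traject _ _ X](prednK n_gt0) /= ffunE dvdn0.
Qed.

Lemma num_necklaces_mod_prime q n : prime n -> num_necklaces q n = 1 %[mod n].
Proof.
move=> n_pr; rewrite /num_necklaces; set S := [set c | _].
have nG : (n.-group <[rotation n]>)%g.
  apply: (@pnat_dvd _ n); last exact: pnat_id.
  by rewrite -orderE order_dvdn rotationX.
have actS : [acts <[rotation n]>, on S | 'P]%g.
  rewrite cycle_subG; apply/astabsP => c.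
  by rewrite !inE /= apermE permE admissible_rotate.
rewrite (pgroup_fix_mod nG actS).
suff -> : 'Fix_(S | 'P)(<[rotation n]>)%g = [set [ffun=> true]] by rewrite cards1.
(* A point is fixed by a cyclic group as soon as its generator fixes it. *)
apply/setP => c; rewrite afix_cycle_in ?inE //.
by rewrite sub1set inE /= apermE permE admissible_rotate_fixed ?prime_gt0.
Qed.

Section Lucas.
Import GRing.Theory ring.
Local Open Scope ring_scope.

Lemma dvdp_lucas (F : fieldType) n :
  ('X^2 - 'X - 1 : {poly F}) %| 'X^n + (1 - 'X) ^+ n - (lucas n)%:R.
Proof.
elim/ltn_ind: n => -[|[|n]] IHn; first by rewrite !expr0 subrr dvdp0.
  by rewrite !expr1 addrCA subrr addr0 subrr dvdp0.
(* The substitution of [1 - 'X] for ['X] preserves ['X^2 - 'X - 1], so both power sequences fail the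
   Lucas recurrence by a multiple of this same polynomial; the last summand collects the two
   errors. *)
have -> : 'X^(n.+2) + (1 - 'X) ^+ n.+2 - (lucas n.+2)%:R =
  ('X^(n.+1) + (1 - 'X) ^+ n.+1 - (lucas n.+1)%:R) +
  ('X^n + (1 - 'X) ^+ n - (lucas n)%:R) +
  ('X^n + (1 - 'X) ^+ n) * ('X^2 - 'X - 1) :> {poly F}.
  have -> : lucas n.+2 = (lucas n.+1 + lucas n)%N by [].
  rewrite natrD !exprS; ring.
by apply: dvdp_add; [apply: dvdp_add; exact: IHn | exact: dvdp_mulIr].
Qed.

Lemma lucas_mod_prime n : prime n -> lucas n = 1%N %[mod n].
Proof.
move=> n_pr; have charF := pchar_Fp n_pr.
have charP : n \in [pchar {poly 'F_n}] by rewrite pchar_poly.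
have := dvdp_lucas 'F_n n.
rewrite -!(pFrobenius_autE charP) -pFrobenius_autD_comm; last exact: mulrC.
rewrite addrCA subrr addr0 pFrobenius_aut1 -polyC_natr -polyCB => dvdC.
have sz : size ('X^2 - 'X - 1 : {poly 'F_n}) = 3.
  rewrite -addrA size_polyDl size_polyXn // -opprD size_polyN.
  by rewrite size_polyDl ?size_polyX ?size_poly1.
(* The dividend is now a constant polynomial; were it nonzero, its size 1 would be at least the size
   3 of its divisor. *)
have : (1 - (lucas n)%:R : 'F_n) == 0.
  apply: contraTT dvdC => nz; apply/negP => /dvdp_leq.
  by rewrite sz polyC_eq0 size_polyC nz => /(_ isT).
rewrite subr_eq0 eq_sym => /eqP /(congr1 (@nat_of_ord _)).
(* With 1 seen as the image of a natural number, both sides evaluate to residues modulo [n]. *)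
by rewrite -[1%R]/(1%:R) !val_Fp_nat.
Qed.

End Lucas.

Theorem corollary1 :
  (forall q n : nat, 1 <= q -> prime n -> num_necklaces q n = 1 %[mod n]) /\
  (forall n : nat, prime n -> lucas n = 1 %[mod n]).
Proof.
split=> [q n _|n]; [exact: num_necklaces_mod_prime | exact: lucas_mod_prime].
Qed.
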